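(* Let $n,p$ be positive integers such that $p$ is odd and $n$ and $n+p$ are relatively prime. Let $\gamma_{n,p}(t)=(\sin(nt),\sin((n+p)t))$, $t_k=\frac{2\pi k}{4n(n+p)}$, and $\mathrm{Lisa}_{n,p}=\{\gamma_{n,p}(t_k): k=1,\ldots,4n(n+p)\}$. For $\mathcal{A}\in\mathrm{Lisa}_{n,p}$ set $w_{\mathcal{A}}=\frac{1}{4n(n+p)}$ if $\mathcal{A}$ lies on the boundary of the square $[-1,1]^2$ and $w_{\mathcal{A}}=\frac{2}{4n(n+p)}$ if $\mathcal{A}$ lies in the interior of $[-1,1]^2$. Then for all $P\in\Pi^Q_{n,p}$, \[ \frac{1}{\pi^2}\int_{-1}^1\int_{-1}^1 P(x,y)\frac{1}{\sqrt{1-x^2}}\frac{1}{\sqrt{1-y^2}}\,dx\,dy=\sum_{\mathcal{A}\in\mathrm{Lisa}_{n,p}} w_{\mathcal{A}}P(\mathcal{A}). \]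
   Context: $T_i(x)=\cos(i\arccos x)$ is the Chebyshev polynomial of the first kind of degree $i$. The index set is $\Gamma^Q_{n,p}=\{(i,j)\in\mathbb{N}_0^2: i+j\le 4n-1\}\cup\bigcup_{m=0}^{4p-1}\{(i,j)\in\mathbb{N}_0^2: i+j=4n+m,\ j<\frac{n(4p-m)}{p}\}$, and $\Pi^Q_{n,p}=\operatorname{span}\{T_i(x)T_j(y):(i,j)\in\Gamma^Q_{n,p}\}$. *)

(* Defs.v *)
From HB Require Import structures.
From mathcomp Require Import all_boot all_order all_algebra.
From mathcomp Require Import all_classical all_reals all_analysis.
Set Implicit Arguments. Unset Strict Implicit. Unset Printing Implicit Defensive.
Import Order.TTheory GRing.Theory Num.Theory.
Local Open Scope ring_scope.

Definition cheb {R : realType} (i : nat) (x : R) : R := cos (i%:R * acos x).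

Definition inGammaQ (n p i j : nat) : bool :=
  (i + j <= 4 * n - 1)%N ||
  [exists m : 'I_(4 * p), (i + j == 4 * n + m)%N && (j * p < n * (4 * p - m))%N].
(* j < n(4p-m)/p  <=>  j*p < n(4p-m)  since p > 0 *)

(* P lies in Pi^Q_{n,p} = span{ T_i(x) T_j(y) : (i,j) in Gamma^Q_{n,p} };
   all indices of Gamma^Q_{n,p} satisfy i,j < 4n+4p *)
Definition inPiQ {R : realType} (n p : nat) (P : R -> R -> R) : Prop :=
  exists c : nat -> nat -> R, forall x y : R,
    P x y = \sum_(i < 4 * n + 4 * p) \sum_(j < 4 * n + 4 * p | inGammaQ n p i j)
              c i j * cheb i x * cheb j y.

Definition gammaLis {R : realType} (n p : nat) (t : R) : R * R :=
  (sin (n%:R * t), sin ((n + p)%:R * t)).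

Definition tk {R : realType} (n p k : nat) : R :=
  2 * pi * k%:R / (4 * n * (n + p))%:R.

Definition Lisa {R : realType} (n p : nat) : seq (R * R) :=
  undup [seq gammaLis n p (tk n p k) | k <- iota 1 (4 * n * (n + p))].

(* weights: boundary of [-1,1]^2 iff |x| = 1 or |y| = 1 (all points lie in [-1,1]^2) *)
Definition wLis {R : realType} (n p : nat) (A : R * R) : R :=
  if (`|A.1| == 1) || (`|A.2| == 1) then 1 / (4 * n * (n + p))%:R
  else 2 / (4 * n * (n + p))%:R.

(* Main.v *)
(** Both sides are linear in [P], so take [P = T_i(x) T_j(y)].

    By orthogonality the integral vanishes unless [i = j = 0].  On the curve,
    [T_i(x_k) T_j(y_k)] is half the sum of two cosines of frequencies
    [i n + j (n+p)] and [i n - j (n+p)] on the grid [2 pi k / N] with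
    [N = 4n(n+p)], so its sum over [k] vanishes unless one frequency is a
    multiple of [N].  Since [n] and [n+p] are coprime this forces [i = (n+p) s]
    and [j = n t] with [s + t] or [s - t] divisible by 4, whereas membership of
    [(i, j)] in the index set forces [s + t < 4].  The only nonzero pair left is
    [s = t = 1], for which the constant term is [cos (p pi / 2) = 0] because [p]
    is odd.

    The weights are multiplicities: exactly one of [n], [n+p] has the parity of
    [k].  Writing [a] for that one and [b] for the other, the only other
    parameter of the node of [k] is the [k'] congruent to [2a - k] modulo [4a]
    and to [k] modulo [4b]; it agrees with [k] modulo [N] exactly when the node
    is on the boundary. *)
Require Import Defs.
From HB Require Import structures.
From mathcomp Require Import all_boot all_order all_algebra.
From mathcomp Require Import all_classical all_reals all_analysis.
From mathcomp Require Import measurable_realfun zify ring lra.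
Set Implicit Arguments. Unset Strict Implicit. Unset Printing Implicit Defensive.
Import Order.TTheory GRing.Theory Num.Theory.
Import numFieldNormedType.Exports.
Local Open Scope ring_scope.
Local Open Scope classical_set_scope.

(** * Integration against the Chebyshev weight by the substitution [x = cos t] *)

Lemma continuous_comp_acos_div (R : realType) (g : R -> R) :
  continuous g ->
  {in `]-1, 1[, continuous (fun x : R => g (acos x) / Num.sqrt (1 - x ^+ 2))}.
Proof.
move=> cg x; rewrite inE /= in_itv /= => x1.
have s0 : 0 < 1 - x ^+ 2 by case/andP: x1 => ? ?; nra.
apply: cvgM.
  apply: (@cvg_comp _ _ _ acos g _ (nbhs (acos x))); last exact: cg.
  exact: continuous_acos.
apply: cvgV; first by rewrite sqrtr_eq0 -ltNge.
apply: (@cvg_comp _ _ _ (fun x : R => 1 - x ^+ 2) Num.sqrt _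
  (nbhs (1 - x ^+ 2))).
  by apply: cvgB; [exact: cvg_cst|exact: exprn_continuous].
exact: sqrt_continuous.
Qed.

Lemma measurable_comp_acos_div (R : realType) (g : R -> R) :
  continuous g ->
  measurable_fun `]-1 : R, 1[ (fun x : R => g (acos x) / Num.sqrt (1 - x ^+ 2)).
Proof.
move=> cg; apply: open_continuous_measurable_fun; first exact: interval_open.
exact: continuous_comp_acos_div.
Qed.

(** The derivative of [acos] is minus the weight, so [- G (acos x)] is a primitive. It is
    differentiated only inside []-1, 1[], hence the cut at [cos e]; [e < pi / 2] keeps the interval
    nondegenerate. *)
Lemma FTC2_comp_acos_div (R : realType) (g G : R -> R) (e : R) :
  continuous g -> (forall t : R, is_derive t 1 G (g t)) -> 0 < e < pi / 2 ->
  (\int[@lebesgue_measure R]_(x in `[(- cos e)%R, (cos e)%R])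
     (g (acos x) / Num.sqrt (1 - x ^+ 2))%:E = (G (pi - e) - G e)%:E)%E.
Proof.
move=> cg dG /andP[e0 epi].
have ppi := pi_gt0 R.
have c0 : 0 < cos e by apply: cos_gt0_pihalf; apply/andP; split; lra.
have c1 : cos e < 1.
  by rewrite -(cos0 R) ltr_cos // in_itv /=; apply/andP; split; lra.
have sub (x : R) : - cos e <= x <= cos e -> -1 < x < 1.
  by move=> /andP[? ?]; apply/andP; split; lra.
pose F x : R := - G (acos x).
have dF (x : R) : -1 < x < 1 ->
    is_derive x 1 F (g (acos x) / Num.sqrt (1 - x ^+ 2)).
  move=> x1; have dacos := is_derive1_acos x1.
  have := @is_derive1_comp _ G acos x _ _ (dG (acos x)) dacos.
  move=> /is_deriveN.
  rewrite (_ : - (_ * _) = g (acos x) / Num.sqrt (1 - x ^+ 2)) //.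
  by ring.
have cF (x : R) : -1 < x < 1 -> {for x, continuous F}.
  move=> x1; apply/differentiable_continuous/derivable1_diffP.
  by have [] := dF _ x1.
rewrite (@continuous_FTC2 _ _ F); last first.
- move=> x; rewrite in_itv /= => /andP[? ?].
  have x1 : -1 < x < 1 by apply: sub; apply/andP; split; lra.
  by rewrite derive1E; have [] := dF _ x1.
- split.
  + move=> x; rewrite in_itv /= => /andP[? ?].
    have x1 : -1 < x < 1 by apply: sub; apply/andP; split; lra.
    by have [] := dF _ x1.
  + by apply: cvg_at_right_filter; apply: cF; apply/andP; split; lra.
  + by apply: cvg_at_left_filter; apply: cF; apply/andP; split; lra.
- apply: continuous_in_subspaceT => x; rewrite inE /= in_itv /= => /sub x1.
  by apply: continuous_comp_acos_div => //; rewrite inE /= in_itv.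
- lra.
rewrite /F acosN ?cosK ?in_itv /=; first last.
- by apply/andP; split; lra.
- by apply/andP; split; lra.
by rewrite -EFinB; congr EFin; ring.
Qed.

(** The intervals of the truncated formula exhaust []-1, 1[]. Monotone convergence, for which [g] is
    taken nonnegative, and continuity of [G] give the limit. *)
Lemma integral_comp_acos_div (R : realType) (g G : R -> R) :
  continuous g -> (forall t : R, 0 <= g t) ->
  (forall t : R, is_derive t 1 G (g t)) ->
  (\int[@lebesgue_measure R]_(x in `](-1)%R, 1%R[)
     (g (acos x) / Num.sqrt (1 - x ^+ 2))%:E = (G pi - G 0)%:E)%E.
Proof.
move=> cg g0 dG; have ppi := pi_gt0 R.
(* A sequence strictly decreasing to 0; the factor [pi / 3] keeps even its first term below
   [pi / 2]. *)
pose e (k : nat) : R := pi / 3 / k.+1%:R.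
have eP k : 0 < e k < pi / 2.
  have k1 : 1 <= k.+1%:R :> R by rewrite ler1n.
  have e3 : e k <= pi / 3.
    by rewrite /e ler_pdivrMr ?ler_peMr //; lra.
  by apply/andP; split; [rewrite /e divr_gt0 //; lra|lra].
have eto0 : e k @[k --> \oo] --> 0.
  rewrite -[X in _ --> X](mulr0 (pi / 3)); apply: cvgMr.
  exact: cvg_harmonic.
pose A k : set R := `[- cos (e k), cos (e k)]%classic.
have cG : continuous G.
  move=> t; apply/differentiable_continuous/derivable1_diffP.
  by have [] := dG t.
have elt k : e k.+1 < e k.
  by rewrite /e ltr_pM2l ?divr_gt0 // ltf_pV2 ?posrE ?ltr0n // ltr_nat.
have cos_e (a b : R) : 0 <= a <= pi -> 0 <= b <= pi -> a < b -> cos b < cos a.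
  by move=> ? ? ?; rewrite ltr_cos // in_itv.
have eA k : A k `<=` `]-1, 1[%classic.
  move=> x; rewrite /A /= !in_itv /= => /andP[xl xr].
  have /andP[? ?] := eP k.
  have : cos (e k) < cos 0 by apply: cos_e => //; apply/andP; split; lra.
  by rewrite cos0 => c1; apply/andP; split; lra.
have ndA : nondecreasing_seq A.
  apply/nondecreasing_seqP => k; rewrite subsetEset => x.
  rewrite /A /= !in_itv /= => /andP[xl xr].
  have /andP[? ?] := eP k; have /andP[? ?] := eP k.+1; have := elt k.
  move=> /cos_e -/(_ _ _)-c.
  have : cos (e k) < cos (e k.+1) by apply: c; apply/andP; split; lra.
  by move=> ?; apply/andP; split; lra.
have UA : \bigcup_k A k = `]-1, 1[%classic.
  apply/seteqP; split; first by move=> x [k _ /eA].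
  move=> x; rewrite /= in_itv /= => x1.
  have ce : (cos \o e) k @[k --> \oo] --> (1 : R).
    rewrite -(cos0 R); apply: (@cvg_comp _ _ _ e cos _ (nbhs 0)) => //.
    exact: continuous_cos.
  have x1' : `|x| < 1 by rewrite ltr_norml.
  have : \forall k \near \oo, `|x| < (cos \o e) k by apply: (cvgr_gt 1).
  case=> k _ /(_ k (leqnn _)) /= xk; exists k => //.
  by rewrite /A /= in_itv /= -ler_norml ltW.
have mf k : measurable_fun (A k)
    (fun x : R => (g (acos x) / Num.sqrt (1 - x ^+ 2))%:E).
  apply/measurable_EFinP.
  by apply: measurable_funS (measurable_comp_acos_div cg) => //.
have f0 k (x : R) : A k x -> (0 <= (g (acos x) / Num.sqrt (1 - x ^+ 2))%:E)%E.
  by move=> _; rewrite lee_fin divr_ge0 // sqrtr_ge0.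
have mA k : measurable (A k) by exact: measurable_itv.
have := @ge0_nondecreasing_set_cvg_integral _ _ _ _ _ (@lebesgue_measure R)
  ndA mA mf f0.
rewrite UA => H; apply: (cvg_unique _ H) => //.
rewrite (_ : (fun i => _) = fun k => (G (pi - e k) - G (e k))%:E); last first.
  by apply/funext => k; rewrite FTC2_comp_acos_div.
apply: cvg_EFin; first exact: nearW.
apply: cvgB; last first.
  by apply: (@cvg_comp _ _ _ e G _ (nbhs 0)) => //; exact: cG.
have epi : pi - e k @[k --> \oo] --> (pi - 0 : R).
  by apply: cvgB => //; exact: cvg_cst.
rewrite subr0 in epi.
by apply: (@cvg_comp _ _ _ (fun k => pi - e k) G _ (nbhs pi)) => //; exact: cG.
Qed.

(** * Integrable functions with a known finite integral *)

(** Integrability travels with the value, so that linearity can be iterated without separate side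
    conditions. *)
Definition has_integral (d : measure_display) (T : measurableType d)
    (R : realType) (mu : {measure set T -> \bar R}) (D : set T)
    (f : T -> R) (v : R) :=
  mu.-integrable D (EFin \o f) /\ (\int[mu]_(x in D) (f x)%:E = v%:E)%E.

Section has_integral.
Variables (d : measure_display) (T : measurableType d) (R : realType).
Variables (mu : {measure set T -> \bar R}) (D : set T).
Hypothesis mD : measurable D.

Lemma has_integralD (f g : T -> R) (u v : R) :
  has_integral mu D f u -> has_integral mu D g v ->
  has_integral mu D (fun x => f x + g x) (u + v).
Proof.
move=> [If fE] [Ig gE]; split.
  exact: (integrableD mD If Ig).
by rewrite EFinD -fE -gE; exact: (integralD_EFin mD If Ig).
Qed.

Lemma has_integralZ (f : T -> R) (a u : R) :
  has_integral mu D f u -> has_integral mu D (fun x => a * f x) (a * u).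
Proof.
move=> [If fE]; split; first exact: (integrableZl mD a If).
by rewrite EFinM -fE; exact: (integralZl mD If).
Qed.

Lemma has_integral0 : has_integral mu D (fun=> 0) 0.
Proof.
split; first exact: integrable0.
by rewrite integral0.
Qed.

Lemma has_integral_sum (I : Type) (r : seq I) (P : pred I)
    (f : I -> T -> R) (v : I -> R) :
  (forall i, P i -> has_integral mu D (f i) (v i)) ->
  has_integral mu D (fun x => \sum_(i <- r | P i) f i x)
    (\sum_(i <- r | P i) v i).
Proof.
move=> fv; elim: r => [|i r IHr].
  rewrite big_nil (_ : (fun=> _) = fun=> 0); first exact: has_integral0.
  by apply/funext => x; rewrite big_nil.
rewrite big_cons (_ : (fun=> _) =
    fun x => if P i then f i x + \sum_(j <- r | P j) f j x
             else \sum_(j <- r | P j) f j x); last first.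
  by apply/funext => x; rewrite big_cons.
by case: ifPn => // Pi; apply: has_integralD => //; exact: fv.
Qed.

Lemma eq_has_integral (f g : T -> R) (v : R) :
  f =1 g -> has_integral mu D f v -> has_integral mu D g v.
Proof. by move=> /funext ->. Qed.

End has_integral.

(** The integrand is its own absolute value, so its finite integral already gives integrability. *)
Lemma has_integral_comp_acos_div (R : realType) (g G : R -> R) :
  continuous g -> (forall t : R, 0 <= g t) ->
  (forall t : R, is_derive t 1 G (g t)) ->
  has_integral (@lebesgue_measure R) `]-1, 1[
    (fun x : R => g (acos x) / Num.sqrt (1 - x ^+ 2))
    (G pi - G 0).
Proof.
move=> cg g0 dG.
have E := integral_comp_acos_div cg g0 dG.
split; last exact: E.
apply/integrableP; split.
  by apply/measurable_EFinP; exact: measurable_comp_acos_div.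
under eq_integral => x _ do rewrite /= ger0_norm ?divr_ge0 ?sqrtr_ge0 //.
by rewrite E ltry.
Qed.

(** * Single and double integrals of Chebyshev polynomials *)

(** With [x = cos t] this is the integral of [cos (i t)] over [[0, pi]]; for [i > 0] the primitive
    [sin (i t) / i] vanishes at both ends. *)
Lemma has_integral_cheb (R : realType) (i : nat) :
  has_integral (@lebesgue_measure R) `]-1, 1[
    (fun x : R => cheb i x / Num.sqrt (1 - x ^+ 2))
    (pi * (i == 0)%:R).
Proof.
have I0 : has_integral (@lebesgue_measure R) `]-1, 1[
    (fun x : R => 1 / Num.sqrt (1 - x ^+ 2)) pi.
  rewrite -[X in has_integral _ _ _ X]subr0.
  apply: (@has_integral_comp_acos_div _ (fun=> 1) id) => // t.
  exact: cvg_cst.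
case: i => [|i] /=.
  rewrite mulr1; apply: eq_has_integral I0 => x.
  by rewrite /cheb mul0r cos0.
(* Adding 1 makes the integrand nonnegative. *)
have I1 : has_integral (@lebesgue_measure R) `]-1, 1[
    (fun x : R => (1 + cos (i.+1%:R * acos x)) / Num.sqrt (1 - x ^+ 2)) pi.
  pose G (t : R) : R := t + i.+1%:R^-1 * sin (i.+1%:R * t).
  have -> : (pi : R) = G pi - G 0.
    have : sin (pi *+ i.+1) = 0 :> R.
      elim: i.+1 => [|k IH]; first by rewrite mulr0n sin0.
      by rewrite mulrSr sinDpi IH oppr0.
    by rewrite /G mulr_natl => ->; rewrite !mulr0 sin0; ring.
  apply: (@has_integral_comp_acos_div _ (fun t => 1 + cos (i.+1%:R * t)) G).
  - move=> t; apply: cvgD; first exact: cvg_cst.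
    apply: (@cvg_comp _ _ _ (fun t => i.+1%:R * t) cos _ (nbhs (i.+1%:R * t))).
      by apply: cvgMr; exact: cvg_id.
    exact: continuous_cos.
  - by move=> t; have := cos_geN1 (i.+1%:R * t); lra.
  - move=> t; rewrite /G; apply: is_derive_eq.
    by rewrite /GRing.scale /=; field; rewrite ?natr1 ?nat1r pnatr_eq0.
rewrite mulr0; rewrite -[0](addrN pi) -[X in _ - X]mul1r -mulNr.
apply: eq_has_integral (has_integralD _ I1 (has_integralZ _ (-1) I0)) => // x.
by rewrite /cheb; ring.
Qed.

(** Bridges to the closed interval of the theorem: the endpoints, where the weight takes the default
    value [1 / 0 = 0], form a null set. *)
Lemma integral_itvcc_has_integral (R : realType) (f : R -> R) (v : R) :
  has_integral (@lebesgue_measure R) `]-1, 1[ f v ->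
  (\int[@lebesgue_measure R]_(x in `[(-1)%R, 1%R]) (f x)%:E = v%:E)%E.
Proof.
by move=> [/integrableP[mf _] <-]; rewrite integral_itv_bndoo.
Qed.

(** For fixed [x] the inner integral is again a finite combination of weighted Chebyshev
    polynomials, now in [x]. The vanishing terms stay in the sum so that it can later be compared
    term by term. *)
Lemma double_integral_cheb (R : realType) (N : nat) (Q : nat -> nat -> bool)
    (c : nat -> nat -> R) :
  (\int[@lebesgue_measure R]_(x in `[(-1)%R, 1%R])
      \int[@lebesgue_measure R]_(y in `[(-1)%R, 1%R])
         ((\sum_(i < N) \sum_(j < N | Q i j) c i j * cheb i x * cheb j y)
           / Num.sqrt (1 - x ^+ 2) / Num.sqrt (1 - y ^+ 2))%:E
   = (\sum_(i < N) \sum_(j < N | Q i j)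
        c i j * ((pi * (i == 0 :> nat)%:R) * (pi * (j == 0 :> nat)%:R)))%:E)%E.
Proof.
pose w (i : nat) (x : R) := cheb i x / Num.sqrt (1 - x ^+ 2).
pose v (i : nat) : R := pi * (i == 0)%:R.
have inner x : has_integral (@lebesgue_measure R) `]-1, 1[
    (fun y : R =>
      (\sum_(i < N) \sum_(j < N | Q i j) c i j * cheb i x * cheb j y)
           / Num.sqrt (1 - x ^+ 2) / Num.sqrt (1 - y ^+ 2))
    (\sum_(i < N) \sum_(j < N | Q i j) (c i j * v j) * w i x).
  suff : has_integral (@lebesgue_measure R) `]-1, 1[
      (fun y : R => \sum_(i < N) \sum_(j < N | Q i j) (c i j * w i x) * w j y)
      (\sum_(i < N) \sum_(j < N | Q i j) (c i j * v j) * w i x).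
    apply: eq_has_integral => y; rewrite !mulr_suml; apply: eq_bigr => i _.
    by rewrite !mulr_suml; apply: eq_bigr => j _; rewrite /w; ring.
  apply: has_integral_sum => // i _; apply: has_integral_sum => // j _.
  rewrite mulrAC; apply: has_integralZ => //; exact: has_integral_cheb.
under eq_integral => x _ do rewrite (integral_itvcc_has_integral (inner x)).
apply: integral_itvcc_has_integral.
apply: has_integral_sum => // i _; apply: has_integral_sum => // j _.
have <- : c i j * v j * v i = c i j * (v i * v j) by ring.
by apply: has_integralZ => //; exact: has_integral_cheb.
Qed.

(** * Chebyshev polynomials at sines, coincidences of sines, and cosine sums *)

(** The three-term recurrence makes [cos (i u)] a polynomial in [cos u]. *)
Lemma eq_cos_natmul (R : realType) (u v : R) (i : nat) :
  cos u = cos v -> cos (i%:R * u) = cos (i%:R * v).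
Proof.
move=> uv.
have rec (t : R) k :
    cos (k.+2%:R * t) = 2 * cos t * cos (k.+1%:R * t) - cos (k%:R * t).
  have -> : k.+2%:R * t = k.+1%:R * t + t by rewrite -[in LHS]natr1; ring.
  have -> : k%:R * t = k.+1%:R * t - t by rewrite -natr1; ring.
  by rewrite cosD cosB; ring.
suff : cos (i%:R * u) = cos (i%:R * v) /\ cos (i.+1%:R * u) = cos (i.+1%:R * v).
  by case.
elim: i => [|i [IH1 IH2]]; first by rewrite !mul0r !mul1r.
by split=> //; rewrite !rec IH1 IH2 uv.
Qed.

(** [acos (sin t)] and [pi / 2 - t] may differ, but they have the same cosine. *)
Lemma cheb_sin (R : realType) (i : nat) (t : R) :
  cheb i (sin t) = cos (i%:R * (pi / 2 - t)).
Proof.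
apply: eq_cos_natmul; rewrite acosK ?in_itv /= ?sin_geN1 ?sin_le1 //.
by rewrite cosB cos_pihalf sin_pihalf; ring.
Qed.

Lemma sin_add_natpi (R : realType) (x : R) (m : nat) :
  sin (x + pi * m%:R) = (-1) ^+ m * sin x.
Proof.
elim: m => [|m IH]; first by rewrite mulr0 addr0 mul1r.
have -> : x + pi * m.+1%:R = x + pi * m%:R + pi by rewrite -natr1; ring.
by rewrite sinDpi IH exprS; ring.
Qed.

Lemma sin_add_nat2pi (R : realType) (x : R) (m : nat) :
  sin (x + 2 * pi * m%:R) = sin x.
Proof.
have -> : 2 * pi * m%:R = pi * (m + m)%:R :> R by rewrite natrD; ring.
by rewrite sin_add_natpi addnn -mul2n exprM sqrrN expr1n expr1n mul1r.
Qed.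

(** Reducing [m] modulo [M] changes only the sign of the sine and brings the angle into [[0, pi[],
    where the sine vanishes only at 0. *)
Lemma sin_pi_ratio_eq0 (R : realType) (m M : nat) : (0 < M)%N ->
  (sin (pi * m%:R / M%:R) == 0 :> R) = (M %| m)%N.
Proof.
move=> M0.
have M0' : M%:R != 0 :> R by rewrite pnatr_eq0 -lt0n.
have -> : pi * m%:R / M%:R = pi * (m %% M)%:R / M%:R + pi * (m %/ M)%:R :> R.
  by rewrite {1}(divn_eq m M) natrD natrM; field.
rewrite sin_add_natpi mulf_eq0 expf_eq0 oppr_eq0 oner_eq0 andbF /= /dvdn.
have [->|r0] := posnP (m %% M)%N; first by rewrite mulr0 mul0r sin0 eqxx.
rewrite gt_eqF; last first.
  apply: sin_gt0_pi; rewrite divr_gt0 ?mulr_gt0 ?pi_gt0 ?ltr0n //=.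
  by rewrite ltr_pdivrMr ?ltr0n // ltr_pM2l ?pi_gt0 // ltr_nat ltn_mod.
by [].
Qed.

Lemma sin_pi_diff_eq0 (R : realType) (m m' M : nat) : (0 < M)%N ->
  (sin (pi * (m%:R - m'%:R) / M%:R) == 0 :> R) = (m == m' %[mod M])%N.
Proof.
move=> M0; have [le|/ltnW le] := leqP m' m.
  by rewrite -natrB // sin_pi_ratio_eq0 // eqn_mod_dvd.
rewrite -opprB mulrN mulNr sinN oppr_eq0 -natrB // sin_pi_ratio_eq0 //.
by rewrite eq_sym eqn_mod_dvd.
Qed.

(** A difference of sines is twice the cosine of the half-sum times the sine of the half-difference.
    The alternatives are the zeros of these factors; the shift by [2 b] is the quarter turn from
    cosine to sine. *)
Lemma eq_sin_node (R : realType) (k k' b : nat) : (0 < b)%N ->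
  (sin (pi * k%:R / (2 * b)%:R) == sin (pi * k'%:R / (2 * b)%:R) :> R) =
  (k == k' %[mod 4 * b])%N || (4 * b %| k + k' + 2 * b)%N.
Proof.
move=> b0; have b0' : b%:R != 0 :> R by rewrite pnatr_eq0 -lt0n.
have -> : pi * k%:R / (2 * b)%:R = pi * (k + k')%:R / (4 * b)%:R +
    pi * (k%:R - k'%:R) / (4 * b)%:R :> R.
  by rewrite !(natrM, natrD); field.
have -> : pi * k'%:R / (2 * b)%:R = pi * (k + k')%:R / (4 * b)%:R -
    pi * (k%:R - k'%:R) / (4 * b)%:R :> R.
  by rewrite !(natrM, natrD); field.
rewrite -subr_eq0 sinD sinB.
set x : R := pi * (k + k')%:R / _; set y : R := _ / _.
have -> : sin x * cos y + cos x * sin y - (sin x * cos y - cos x * sin y)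
  = 2 * (cos x * sin y) by ring.
rewrite mulf_eq0 pnatr_eq0 /= mulf_eq0 orbC.
rewrite /y sin_pi_diff_eq0 ?muln_gt0 //.
rewrite -sinDpihalf (_ : x + pi / 2 = pi * (k + k' + 2 * b)%:R / (4 * b)%:R).
  by rewrite sin_pi_ratio_eq0 ?muln_gt0.
by rewrite /x !(natrM, natrD); field.
Qed.

Lemma norm_sin_node_eq1 (R : realType) (k b : nat) : (0 < b)%N ->
  (`|sin (pi * k%:R / (2 * b)%:R) : R| == 1) = (2 * b %| k + b)%N.
Proof.
move=> b0; have b0' : b%:R != 0 :> R by rewrite pnatr_eq0 -lt0n.
rewrite norm_sin_eq1 -sinDpihalf -(@sin_pi_ratio_eq0 R) ?muln_gt0 //.
by congr (sin _ == 0); rewrite !(natrM, natrD); field.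
Qed.

(** Writing the integer frequency as a difference of naturals turns its divisibility by [N] into a
    congruence. *)
Lemma sum_cos_eq0 (R : realType) (x : R) (N m m' : nat) : (0 < N)%N ->
  (m != m' %[mod N])%N ->
  \sum_(1 <= k < N.+1) cos (x + 2 * pi * (m%:R - m'%:R) * k%:R / N%:R) = 0.
Proof.
move=> N0 mm'; have N0' : N%:R != 0 :> R by rewrite pnatr_eq0 -lt0n.
pose h : R := pi * (m%:R - m'%:R) / N%:R.
have h0 : sin h != 0 by rewrite sin_pi_diff_eq0.
(* Multiplying by [2 * sin h] makes the sum telescope. *)
apply: (mulfI h0); rewrite mulr0; apply: (mulfI (_ : 2 != 0 :> R)).
  by rewrite pnatr_eq0.
rewrite mulr0 mulrA big_distrr /=.
rewrite (eq_bigr (fun k =>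
  sin (x + h * (2 * k.+1%:R - 1)) - sin (x + h * (2 * k%:R - 1)))).
  rewrite telescope_sumr //.
  have -> : x + h * (2 * N.+1%:R - 1) =
      x + h * (2 * 1 - 1) + 2 * pi * (m%:R - m'%:R).
    by rewrite /h -natr1; field.
  set z := x + h * (2 * 1 - 1).
  (* The end angles differ by [m - m'] full turns; adding [m'] turns makes the count a natural
     number. *)
  rewrite -(sin_add_nat2pi (z + _) m').
  have -> : z + 2 * pi * (m%:R - m'%:R) + 2 * pi * m'%:R = z + 2 * pi * m%:R.
    by ring.
  by rewrite sin_add_nat2pi subrr.
move=> k _; rewrite -[k.+1%:R]natr1.
have -> : x + h * (2 * (k%:R + 1) - 1) =
    x + 2 * pi * (m%:R - m'%:R) * k%:R / N%:R + h.
  by rewrite /h; field.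
have -> : x + h * (2 * k%:R - 1) =
    x + 2 * pi * (m%:R - m'%:R) * k%:R / N%:R - h.
  by rewrite /h; field.
by rewrite sinD sinB; ring.
Qed.

(** * Frequencies allowed by the index set, and sums over the parameters *)

(** In the triangle, [n (s + t) <= (n + p) s + n t < 4 n]. Beyond it, adding [p t < 4 p - m] to
    [(n + p) s + n t = 4 n + m] gives [(n + p) (s + t) < 4 (n + p)]. *)
Lemma inGammaQ_lattice (n p s t : nat) : (0 < n)%N -> (0 < p)%N ->
  inGammaQ n p ((n + p) * s) (n * t) -> (s + t < 4)%N.
Proof.
move=> n0 p0 /orP[H|/existsP[[m mlt] /= /andP[/eqP E H]]].
  have : (n * (s + t) < n * 4)%N by nia.
  by rewrite ltn_pmul2l.
have H' : (t * p < 4 * p - m)%N by rewrite -(ltn_pmul2l n0); nia.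
have : ((n + p) * (s + t) < (n + p) * 4)%N by nia.
by rewrite ltn_pmul2l // addn_gt0 n0.
Qed.

Lemma sum_frequency_dvd (n p i j : nat) : (0 < n)%N -> (0 < p)%N ->
  coprime n (n + p) -> inGammaQ n p i j ->
  (4 * n * (n + p) %| i * n + j * (n + p))%N -> (i == 0%N) && (j == 0%N).
Proof.
move=> n0 p0 cop G dv.
have /dvdnP[s Ei] : (n + p %| i)%N.
  rewrite -(@Gauss_dvdl _ _ n); last by rewrite coprime_sym.
  rewrite -(@dvdn_addl (j * (n + p))) ?dvdn_mull //.
  by rewrite (dvdn_trans _ dv) ?dvdn_mull.
have /dvdnP[t Ej] : (n %| j)%N.
  rewrite -(@Gauss_dvdl _ _ (n + p)) //.
  rewrite -(@dvdn_addr (i * n)) ?dvdn_mull // (dvdn_trans _ dv) //.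
  by rewrite mulnAC dvdn_mull.
move: G; rewrite Ei Ej [(s * _)%N]mulnC [(t * _)%N]mulnC => /inGammaQ_lattice.
move=> /(_ n0 p0) st.
have : (n * (n + p) * 4 %| n * (n + p) * (s + t))%N.
  by move: dv; rewrite Ei Ej; congr (_ %| _)%N; ring.
rewrite dvdn_pmul2l; last by rewrite muln_gt0 addn_gt0 n0.
by move=> /dvdnP[q E]; rewrite !muln_eq0; lia.
Qed.

(** Cancelling [n (n + p)] leaves [s] and [t] congruent modulo 4; as [s + t < 4], they are equal, to
    0 or to 1. *)
Lemma diff_frequency_dvd (n p i j : nat) : (0 < n)%N -> (0 < p)%N ->
  coprime n (n + p) -> inGammaQ n p i j ->
  (i * n == j * (n + p) %[mod 4 * n * (n + p)])%N ->
  (i == 0%N) && (j == 0%N) || (i == (n + p)%N) && (j == n).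
Proof.
move=> n0 p0 cop G dv.
have dvd (d : nat) : (d %| 4 * n * (n + p))%N ->
    (i * n == j * (n + p) %[mod d])%N.
  by move=> D; rewrite -(modn_dvdm _ D) (eqP dv) modn_dvdm.
have /dvdnP[s Ei] : (n + p %| i)%N.
  rewrite -(@Gauss_dvdl _ _ n); last by rewrite coprime_sym.
  by rewrite /dvdn (eqP (dvd (n + p)%N _)) ?dvdn_mull // modnMl.
have /dvdnP[t Ej] : (n %| j)%N.
  rewrite -(@Gauss_dvdl _ _ (n + p)) //.
  by rewrite /dvdn -(eqP (dvd n _)) ?modnMl // mulnAC dvdn_mull.
move: G; rewrite Ei Ej [(s * _)%N]mulnC [(t * _)%N]mulnC => /inGammaQ_lattice.
move=> /(_ n0 p0) st.
have nn0 : (0 < n * (n + p))%N by rewrite muln_gt0 addn_gt0 n0.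
have : (s == t %[mod 4])%N.
  rewrite -(eqn_pmul2l nn0) !muln_modr; move: dv; rewrite Ei Ej.
  by congr (_ %% _ == _ %% _)%N; ring.
move=> E; have : (s == 0%N) && (t == 0%N) || (s == 1%N) && (t == 1%N) by lia.
by case/orP=> /andP[/eqP -> /eqP ->]; rewrite ?muln0 ?muln1 ?eqxx ?orbT.
Qed.

Lemma sum_cheb_nodes (R : realType) (n p i j : nat) : (0 < n)%N -> (0 < p)%N ->
  odd p -> coprime n (n + p) -> inGammaQ n p i j ->
  \sum_(1 <= k < (4 * n * (n + p)).+1)
     cheb i (gammaLis n p (tk n p k)).1 * cheb j (gammaLis n p (tk n p k)).2
  = (4 * n * (n + p))%:R * ((i == 0%N)%:R * (j == 0%N)%:R) :> R.
Proof.
move=> n0 p0 oddp cop G.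
have [/andP[/eqP-> /eqP->]|ij0] := boolP ((i == 0%N) && (j == 0%N)).
  rewrite mulr1 mulr1 (eq_bigr (fun=> 1)).
    by rewrite sumr_const_nat subn1.
  by move=> k _; rewrite /cheb !mul0r cos0 mulr1.
rewrite -natrM mulnb (negbTE ij0) mulr0.
set N := (4 * n * (n + p))%N.
have N0 : (0 < N)%N by rewrite !muln_gt0 n0 addn_gt0 n0.
have N0' : N%:R != 0 :> R by rewrite pnatr_eq0 -lt0n.
(* For the angles [u], [v] of the two factors, [x] and [y] are the values of [- (u + v)] and [v - u]
   at [t = 0]. *)
pose x : R := - ((i%:R + j%:R) * (pi / 2)).
pose y : R := (j%:R - i%:R) * (pi / 2).
pose m := (i * n + j * (n + p))%N.
rewrite (eq_bigr (fun k =>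
    2^-1 * cos (x + 2 * pi * (m%:R - 0%:R) * k%:R / N%:R) +
    2^-1 * cos (y + 2 * pi * ((i * n)%:R - (j * (n + p))%:R) * k%:R / N%:R))).
  rewrite big_split -!big_distrr /= sum_cos_eq0 //; last first.
    by apply: contra ij0; rewrite mod0n; exact: sum_frequency_dvd.
  rewrite mulr0 add0r.
  have [/(diff_frequency_dvd n0 p0 cop G)|] :=
      boolP (i * n == j * (n + p) %[mod N])%N.
    rewrite (negbTE ij0) /= => /andP[/eqP Ei /eqP Ej].
    rewrite big1 ?mulr0 // => k _.
    have -> : y = - (pi * p%:R / 2) by rewrite /y Ei Ej natrD; ring.
    rewrite Ei Ej mulnC subrr mulr0 !mul0r addr0 cosN -sinDpihalf.
    have -> : pi * p%:R / 2 + pi / 2 = pi * p.+1%:R / 2%:R :> R.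
      by rewrite -natr1; ring.
    by apply/eqP; rewrite sin_pi_ratio_eq0 // dvdn2 /= oddp.
  by move=> mm; rewrite sum_cos_eq0 // mulr0.
move=> k _; rewrite /gammaLis /= !cheb_sin /tk -/N.
move: (N) N0' => M M0.
set u : R := i%:R * _; set v : R := j%:R * _.
have -> : x + 2 * pi * (m%:R - 0%:R) * k%:R / M%:R = - (u + v).
  by rewrite /u /v /x /m !natrD !natrM natrD; field.
have -> : y + 2 * pi * ((i * n)%:R - (j * (n + p))%:R) * k%:R / M%:R = v - u.
  by rewrite /u /v /y !natrM natrD; field.
by rewrite cosN cosD cosB; field.
Qed.

(** * Multiplicity of the nodes *)

(** For coprime [a] and [b], the least common multiple of [4 a] and [4 b] is [4 a b]. *)
Lemma eqn_mod4_mul (a b k l : nat) : coprime a b ->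
  (k == l %[mod 4 * a * b])%N =
  (k == l %[mod 4 * a])%N && (k == l %[mod 4 * b])%N.
Proof.
move=> cop; wlog le : k l / (l <= k)%N => [H|].
  case: (leqP l k) => [|/ltnW] /H // E.
  by rewrite eq_sym [(k %% (4 * a) == _)%N]eq_sym [(k %% (4 * b) == _)%N]eq_sym.
rewrite !eqn_mod_dvd //; apply/idP/andP => [D|[/dvdnP[s Es] Db]].
  by split; apply: dvdn_trans D; [rewrite dvdn_mulr | rewrite mulnAC dvdn_mulr].
move: Db; rewrite Es (_ : s * (4 * a) = 4 * (a * s))%N; last by ring.
rewrite -mulnA ![(4 * _ %| 4 * _)%N]dvdn_pmul2l //.
rewrite Gauss_dvdr; last by rewrite coprime_sym.
by move=> bs; rewrite Gauss_dvd // dvdn_mulr //= dvdn_mull.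
Qed.

(** Modulo 4, [k + k0 + 2 b] is [2 (k0 + b)] in the first case and [2 (b - a)] in the second: twice
    an odd number. *)
Lemma twin_node_mod4 (a b k k0 : nat) : odd (a + b) -> odd k0 = odd a ->
  (k == k0 %[mod 4])%N || (4 %| k + k0 + 2 * a)%N ->
  ~~ (4 %| k + k0 + 2 * b)%N.
Proof.
rewrite oddD => oab ok0 H; apply/negP => /dvdnP[q Eq].
have Ea := odd_double_half a; have Eb := odd_double_half b.
have Ek := odd_double_half k0; rewrite ok0 in Ek.
rewrite -muln2 in Ea; rewrite -muln2 in Eb; rewrite -muln2 in Ek.
case/orP: H => [|/dvdnP[r Er]].
  have Dk := divn_eq k 4; have Dk0 := divn_eq k0 4.
  move=> /eqP E; rewrite E in Dk; move: oab Ea Eb Ek.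
  case: (odd a); case: (odd b) => //= _;
    move: a./2 b./2 k0./2 (k %/ 4)%N (k0 %/ 4)%N (k0 %% 4)%N Dk Dk0;
    clear -Eq; lia.
move: oab Ea Eb Ek; case: (odd a); case: (odd b) => //= _;
  move: a./2 b./2 k0./2; clear -Eq Er; lia.
Qed.

(** Each coordinate matches by congruence or by reflection. Reflection in the [b] coordinate is
    impossible modulo 4, so only [k0] and its reflection [k'] in the [a] coordinate remain. The last
    two clauses say when the coordinates are extremal. *)
Lemma exists_twin_node (a b k0 : nat) : (0 < a)%N -> coprime a b ->
  odd (a + b) -> odd k0 = odd a ->
  exists k', [/\ forall k,
      ((k == k0 %[mod 4 * a])%N || (4 * a %| k + k0 + 2 * a)%N) &&
      ((k == k0 %[mod 4 * b])%N || (4 * b %| k + k0 + 2 * b)%N) =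
      (k == k0 %[mod 4 * a * b])%N || (k == k' %[mod 4 * a * b])%N,
    (k0 == k' %[mod 4 * a * b])%N = (2 * a %| k0 + a)%N &
    (2 * b %| k0 + b)%N = false].
Proof.
move=> a0 cop oab ok0.
(* [k0] and [a] have the same parity. The reflection condition on [k0 + 4 z] then reads
   [a %| d + z]. *)
have [d Ed] : exists d, (2 * k0 + 2 * a = 4 * d)%N.
  by exists (k0 + a)./2; lia.
(* [k' = k0 + 4 * z] needs [z = - d] modulo [a] and [z = 0] modulo [b]. *)
pose z := chinese a b (d * (a - 1)) 0.
have za : (a %| d + z)%N.
  rewrite /dvdn -modnDmr chinese_modl // modnDmr.
  have -> : (d + d * (a - 1) = d * a)%N by nia.
  by rewrite modnMl.
have zb : (b %| z)%N by rewrite /dvdn chinese_modr // mod0n.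
exists (k0 + 4 * z)%N.
have k'b : (k0 == k0 + 4 * z %[mod 4 * b])%N.
  by rewrite -{1}[k0]addn0 eqn_modDl mod0n eq_sym -/(dvdn _ _) dvdn_pmul2l.
have k'a k : (k == k0 + 4 * z %[mod 4 * a])%N = (4 * a %| k + k0 + 2 * a)%N.
  rewrite -(eqn_modDr (k0 + 2 * a)) addnA.
  have -> : (k0 + 4 * z + (k0 + 2 * a) = 4 * (d + z))%N by lia.
  by rewrite -muln_modr (eqP za) muln0.
have mod4 c k l : (k == l %[mod 4 * c])%N -> (k == l %[mod 4])%N.
  move=> /eqP E; rewrite -(@modn_dvdm (4 * c)) ?dvdn_mulr // E.
  by rewrite modn_dvdm ?dvdn_mulr.
have dvd4 c k : (4 * c %| k)%N -> (4 %| k)%N.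
  by apply: dvdn_trans; rewrite dvdn_mulr.
split.
- move=> k; rewrite !eqn_mod4_mul // k'a -(eqP k'b) -andb_orl.
  case: (boolP (k == k0 %[mod 4 * b])%N) => kb; rewrite ?andbT //= andbF.
  apply/negbTE; rewrite negb_and -implybE; apply/implyP => ka.
  apply: contra (@twin_node_mod4 a b k k0 oab ok0 _); first exact: dvd4.
  by case/orP: ka => [/mod4 ->|/dvd4 ->]; rewrite ?orbT.
- rewrite eqn_mod4_mul // k'b andbT k'a.
  have -> : (4 * a = 2 * (2 * a))%N by ring.
  have -> : (k0 + k0 + 2 * a = 2 * (k0 + a))%N by ring.
  by rewrite dvdn_pmul2l.
apply/negbTE; apply: contraL oab => /(dvdn_trans (dvdn_mulr b (dvdnn 2))).
by rewrite dvdn2 !oddD ok0.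
Qed.

Lemma count_residue (N r : nat) : (0 < N)%N ->
  count (fun k => k == r %[mod N])%N (iota 1 N) = 1%N.
Proof.
(* The range starts at 1, so the residue 0 is represented by [N]. *)
move=> N0; pose r' := if (r %% N)%N is 0 then N else (r %% N)%N.
have r'in : r' \in iota 1 N.
  rewrite mem_iota /r'; have := ltn_pmod r N0.
  by case: (r %% N)%N => [|m]; lia.
rewrite -[RHS]/(true : nat) -r'in -(count_uniq_mem _ (iota_uniq _ _)).
apply: eq_in_count => k; rewrite mem_iota => /andP[k0 kN] /=.
have [E|ltk] := eqVneq k N.
  rewrite E modnn /r'; have := ltn_pmod r N0.
  by case: (r %% N)%N => [|m] //=; lia.
rewrite (@modn_small k) /r'; last lia.
by case: (r %% N)%N => [|m] //; lia.
Qed.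

Lemma count_residue2 (N r r' : nat) : (0 < N)%N ->
  count (fun k => (k == r %[mod N]) || (k == r' %[mod N]))%N (iota 1 N) =
  if (r == r' %[mod N])%N then 1%N else 2.
Proof.
move=> N0; case: ifPn => rr'.
  apply: etrans (count_residue r N0); apply: eq_count => k.
  by rewrite -(eqP rr') orbb.
have := count_predUI (fun k => k == r %[mod N])%N
  (fun k => k == r' %[mod N])%N (iota 1 N).
rewrite !count_residue // (@eq_count _ (predI _ _) pred0).
  by rewrite count_pred0 addn0.
move=> k /=; apply/negbTE; apply: contra rr' => /andP[/eqP <- /eqP <-].
by rewrite eqxx.
Qed.

(** Each frequency cancels against the grid, so the denominators appear in swapped order: [n + p]
    first. *)
Lemma gammaLis_tkE (R : realType) (n p k : nat) : (0 < n)%N ->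
  gammaLis n p (tk n p k) =
  (sin (pi * k%:R / (2 * (n + p))%:R), sin (pi * k%:R / (2 * n)%:R)) :> R * R.
Proof.
move=> n0; have n0' : n%:R != 0 :> R by rewrite pnatr_eq0 -lt0n.
have np0' : (n + p)%:R != 0 :> R by rewrite pnatr_eq0 -lt0n addn_gt0 n0.
rewrite /gammaLis /tk !natrM.
by congr (sin _, sin _); move: ((n + p)%:R) np0' => b b0; field; rewrite n0' b0.
Qed.

Lemma count_mem_node (R : realType) (n p k0 : nat) : (0 < n)%N -> odd p ->
  coprime n (n + p) ->
  let A : R * R := gammaLis n p (tk n p k0) in
  count_mem A [seq gammaLis n p (tk n p k) | k <- iota 1 (4 * n * (n + p))] =
  if (`|A.1| == 1) || (`|A.2| == 1) then 1%N else 2.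
Proof.
move=> n0 oddp cop A.
have np0 : (0 < n + p)%N by rewrite addn_gt0 n0.
have N0 : (0 < 4 * n * (n + p))%N by rewrite !muln_gt0 n0.
have onp : odd (n + (n + p)) by rewrite addnA addnn oddD odd_double.
rewrite count_map /A gammaLis_tkE //= !norm_sin_node_eq1 //.
set a := preim _ _.
have aE k : a k =
    ((k == k0 %[mod 4 * n])%N || (4 * n %| k + k0 + 2 * n)%N) &&
    ((k == k0 %[mod 4 * (n + p)])%N || (4 * (n + p) %| k + k0 + 2 * (n + p))%N).
  by rewrite /a /= gammaLis_tkE // xpair_eqE !eq_sin_node // andbC.
(* Since [p] is odd, [k0] shares its parity with exactly one of [n] and [n + p], which takes the
   role of [a]. *)
have [ok0|ok0] := eqVneq (odd k0) (odd n).
  have [k' [tw <- ->]] := exists_twin_node n0 cop onp ok0.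
  by rewrite -count_residue2 //; apply: eq_count => k; rewrite aE tw.
have ok0' : odd k0 = odd (n + p).
  by move: ok0; rewrite oddD oddp; case: (odd k0); case: (odd n).
rewrite coprime_sym in cop; rewrite addnC in onp.
have [k' [tw <- ->]] := exists_twin_node np0 cop onp ok0'.
rewrite orbF mulnAC -count_residue2 1?mulnAC //.
by apply: eq_count => k; rewrite aE andbC tw mulnAC.
Qed.

(** * From points to parameters, and the cubature formula *)

(** The weight of a point is its number of parameters divided by [4 n (n + p)]. *)
Lemma sum_Lisa (R : realType) (n p : nat) (P : R -> R -> R) : (0 < n)%N ->
  odd p -> coprime n (n + p) ->
  \sum_(A <- Lisa n p) wLis n p A * P A.1 A.2 =
  (\sum_(1 <= k < (4 * n * (n + p)).+1)
     P (gammaLis n p (tk n p k)).1 (gammaLis n p (tk n p k)).2)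
  / (4 * n * (n + p))%:R.
Proof.
move=> n0 oddp cop; rewrite mulr_suml /index_iota subn1 /=.
set N := (4 * n * (n + p))%N.
rewrite -(big_map (fun k => gammaLis n p (tk n p k)) xpredT
  (fun A => P A.1 A.2 / N%:R)).
rewrite -[RHS](big_undup_iterop_count +%R) /= /Lisa !big_seq.
apply: eq_bigr => A; rewrite mem_undup => /mapP[k _ ->].
rewrite count_mem_node // /wLis -/N.
by case: ifP => _ /=; field; rewrite pnatr_eq0 -lt0n !muln_gt0 addn_gt0 n0.
Qed.

Theorem theorem1 (R : realType) (n p : nat) (hn : (0 < n)%N) (hp : (0 < p)%N)
  (hodd : odd p) (hcop : coprime n (n + p)) (P : R -> R -> R)
  (hP : inPiQ n p P) :
  ((pi ^- 2)%:E *
     \int[@lebesgue_measure R]_(x in `[(-1)%R, 1%R]%classic)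
        \int[@lebesgue_measure R]_(y in `[(-1)%R, 1%R]%classic)
           (P x y / Num.sqrt (1 - x ^+ 2) / Num.sqrt (1 - y ^+ 2))%:E)%E
  = (\sum_(A <- Lisa n p) wLis n p A * P A.1 A.2)%:E.
Proof.
have [c PE] := hP.
rewrite sum_Lisa //; set N := (4 * n * (n + p))%N.
have N0 : N%:R != 0 :> R by rewrite pnatr_eq0 -lt0n !muln_gt0 addn_gt0 hn.
under eq_integral do under eq_integral do rewrite PE.
rewrite double_integral_cheb -EFinM; congr EFin.
under [in RHS]eq_bigr do rewrite PE.
(* With the sum over [k] innermost, both sides agree for each pair [(i, j)] separately. *)
rewrite exchange_big /= mulr_sumr mulr_suml; apply: eq_bigr => i _.
rewrite exchange_big /= mulr_sumr mulr_suml; apply: eq_bigr => j Gij.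
under [in RHS]eq_bigr do rewrite -mulrA.
rewrite -mulr_sumr sum_cheb_nodes // -/N.
move: N N0 (pi : R) (lt0r_neq0 (pi_gt0 R)) => N N0 q q0.
by field; rewrite N0 q0.
Qed.
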